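(* Let $f:A\to B$ be a homomorphism of commutative rings with unity, let $J$ be an ideal of $B$, and let $A\bowtie^f J=\{(a,f(a)+j)\mid a\in A,\ j\in J\}\subseteq A\times B$. Then: (1) If $I$ is an ideal of $A$ and $H$ is an ideal of the ring $f(A)+J$ such that $f(I)J\subseteq H\subseteq J$, then $I\bowtie^f H:=\{(i,f(i)+h)\mid i\in I,\ h\in H\}$ is an ideal of $A\bowtie^f J$. (2) If $I$ is an ideal of $A$, then the extension $I(A\bowtie^f J)$ of $I$ to $A\bowtie^f J$ coincides with $I\bowtie^f (f(I)B)J:=\{(i,f(i)+\beta)\mid i\in I,\ \beta\in (f(I)B)J\}$. (3) If $I$ is an ideal of $A$ such that $f(I)B=B$, then $I(A\bowtie^f J)=\{(i,f(i)+j)\mid i\in I,\ j\in J\}$.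
   Context: $A\bowtie^f J$ is a subring of $A\times B$ (the amalgamation of $A$ with $B$ along $J$ with respect to $f$), viewed as a ring extension of $A$ via the embedding $\iota:A\to A\bowtie^f J$, $a\mapsto (a,f(a))$; the extension $I(A\bowtie^f J)$ is the ideal generated by $\iota(I)$. $f(A)+J=\{f(a)+j\mid a\in A,\ j\in J\}$ is a subring of $B$. $f(I)B$ is the ideal of $B$ generated by $f(I)$, and $(f(I)B)J$ is the product of ideals of $B$. *)

(* Defs.v *)
From mathcomp Require Import all_boot all_algebra.
From mathcomp Require Import boolp classical_sets.

Set Implicit Arguments.
Unset Strict Implicit.
Unset Printing Implicit Defensive.

Import GRing.Theory.
Local Open Scope ring_scope.
Local Open Scope classical_set_scope.

(* [ideal_of S I]: the set I is an ideal of S, where S is (the carrier of) a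
   subring of the ambient commutative ring R; ideals of R itself are obtained
   with S = setT. Closure under opposites follows since -1 belongs to S.
   The ideals of ring_quotient are required to be proper, so they do not fit
   here: the unit ideal must be allowed. *)
Definition ideal_of (R : comPzRingType) (S I : set R) : Prop :=
  [/\ I `<=` S,
      I 0,
      (forall x y, I x -> I y -> I (x + y)) &
      (forall s x, S s -> I x -> I (s * x))].

(* The ideal of the subring S generated by X (meaningful for X `<=` S). *)
Definition ideal_gen (R : comPzRingType) (S X : set R) : set R :=
  smallest (ideal_of S) X.

(* X Y = the set of all finite sums of products x * y, with x in X, y in Y. *)
Definition set_prod (R : comPzRingType) (X Y : set R) : set R :=
  [set z | exists (n : nat) (x y : 'I_n -> R),
     (forall k, X (x k) /\ Y (y k)) /\ z = \sum_(k < n) x k * y k].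

Section Amalgamation.
Variables (A B : comPzRingType) (f : {rmorphism A -> B}).

(* I ⋈^f H, as a subset of the product ring A * B. *)
Definition bowtie (I : set A) (H : set B) : set (A * B)%type :=
  [set (i, f i + h) | i in I & h in H].

Definition amalgamation (J : set B) : set (A * B)%type := bowtie setT J.

Definition image_plus (J : set B) : set B :=
  [set f a + j | a in setT & j in J].

Definition iota (a : A) : (A * B)%type := (a, f a).

(* I(A ⋈^f J) *)
Definition extension (J : set B) (I : set A) : set (A * B)%type :=
  ideal_gen (amalgamation J) (iota @` I).

Lemma ideal_ofN (R : comPzRingType) (J : set R) x :
  ideal_of setT J -> J x -> J (- x).
Proof. by case=> _ _ _ JM Jx; rewrite -mulN1r; apply: JM. Qed.

Lemma image_plus_subring (J : set B) :
  ideal_of setT J -> subring_closed [in image_plus J].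
Proof.
move=> iJ; have [_ J0 JD JM] := iJ; split.
- by apply/mem_set; exists 1 => //; exists 0; rewrite ?rmorph1 ?addr0.
- move=> _ _ /set_mem [a _ [j Jj <-]] /set_mem [b _ [k Jk <-]].
  apply/mem_set; exists (a - b) => //; exists (j - k).
    by apply: JD => //; apply: ideal_ofN.
  by rewrite rmorphB opprD addrACA.
- move=> _ _ /set_mem [a _ [j Jj <-]] /set_mem [b _ [k Jk <-]].
  apply/mem_set; exists (a * b) => //; exists (f a * k + (f b + k) * j).
    by apply: JD; apply: JM.
  by rewrite rmorphM [RHS]mulrDl [f a * (_ + _)]mulrDr -addrA [j * _]mulrC.
Qed.

Lemma amalgamation_subring (J : set B) :
  ideal_of setT J -> subring_closed [in amalgamation J].
Proof.
move=> iJ; have [_ J0 JD JM] := iJ; split.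
- by apply/mem_set; exists 1 => //; exists 0; rewrite ?rmorph1 ?addr0.
- move=> _ _ /set_mem [a _ [j Jj <-]] /set_mem [b _ [k Jk <-]].
  apply/mem_set; exists (a - b) => //; exists (j - k).
    by apply: JD => //; apply: ideal_ofN.
  by congr pair; rewrite /= rmorphB opprD addrACA.
- move=> _ _ /set_mem [a _ [j Jj <-]] /set_mem [b _ [k Jk <-]].
  apply/mem_set; exists (a * b) => //; exists (f a * k + (f b + k) * j).
    by apply: JD; apply: JM.
  by congr pair; rewrite /= rmorphM [RHS]mulrDl [f a * (_ + _)]mulrDr -addrA [j * _]mulrC.
Qed.

Lemma iota_amalgamation (J : set B) (a : A) :
  ideal_of setT J -> amalgamation J (iota a).
Proof. by case=> _ J0 _ _; exists a => //; exists 0; rewrite ?addr0. Qed.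

End Amalgamation.

(* Main.v *)
Require Import Defs.
From mathcomp Require Import all_boot all_algebra.
From mathcomp Require Import boolp classical_sets.

Import GRing.Theory.
Local Open Scope ring_scope.
Local Open Scope classical_set_scope.

(** Everything rests on the product formula
      (a, f a + j) (i, f i + h) = (a i, f (a i) + (f i j + (f a + j) h)),
    whose correction term lies in H as soon as H contains f(I) J and is stable
    under multiplication by f(A) + J: this is part (1), [bowtie_ideal].

    For part (2), H = (f(I)B) J satisfies the hypotheses of part (1), so
    I ⋈ H is an ideal containing every iota i = (i, f i + 0), hence contains
    the extension E of I.  Conversely (i, f i + b) = iota i + (0, b), so it is
    enough that (0, b) lies in E for b in (f(I)B) J.  The point is that the
    products to control have a factor in f(I)B, whereas E is only stable under
    multiplication by A ⋈ J, which need not contain (0, s) for s in B.  Yet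
    the transporter {b | (0, b j) in E for all j in J} is an ideal of the
    whole of B, because a factor s can be moved from b to j; it contains f(I)
    since (0, f i j) = (0, j) (i, f i), hence it contains f(I)B
    ([extension_zero_prod]).

    Part (3) is the case f(I)B = B of part (2), as B J = J. *)

(** The ideal I only serves to make the family of ideals containing X
    nonempty: the intersection of an empty family is all of R, which need not
    lie in S. *)
Lemma ideal_gen_ideal (R : comPzRingType) (S X I : set R) :
  ideal_of S I -> X `<=` I -> ideal_of S (ideal_gen S X).
Proof.
move=> idI XI; split.
- by move=> x genx; case: (idI) => IS _ _ _; apply/IS/(genx I).
- by move=> K [[]].
- move=> x y genx geny K idK; case: (idK) => -[_ _ KD _] _.
  by apply: KD; [apply: genx | apply: geny].
- move=> s x Ss genx K idK; case: (idK) => -[_ _ _ KM] _.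
  by apply: KM => //; apply: genx.
Qed.

Lemma mem_set_prod (R : comPzRingType) (X Y : set R) x y :
  X x -> Y y -> set_prod X Y (x * y).
Proof.
by move=> Xx Yy; exists 1%N, (fun=> x), (fun=> y); split; rewrite ?big_ord1.
Qed.

Lemma set_prod_sub (R : comPzRingType) (X Y K : set R) :
  K 0 -> (forall u v, K u -> K v -> K (u + v)) ->
  (forall x y, X x -> Y y -> K (x * y)) -> set_prod X Y `<=` K.
Proof.
move=> K0 KD KXY _ [n [x [y [XY ->]]]].
by apply: big_ind => // k _; have [Xx Yy] := XY k; apply: KXY.
Qed.

(** A factor s is absorbed by J, so X may be an arbitrary set. *)
Lemma set_prod_ideal (R : comPzRingType) (X J : set R) :
  ideal_of setT J -> ideal_of setT (set_prod X J).
Proof.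
move=> [_ J0 _ JM]; split=> //.
- by exists 0%N, (fun=> 0), (fun=> 0); split; [case | rewrite big_ord0].
- move=> _ _ [m [x [y [XY ->]]]] [n [x' [y' [XY' ->]]]].
  pose glue (g : 'I_m -> R) (g' : 'I_n -> R) (k : 'I_(m + n)) :=
    match split k with inl a => g a | inr b => g' b end.
  exists (m + n)%N, (glue x x'), (glue y y'); split.
    by rewrite /glue => k; case: (split k).
  rewrite big_split_ord /glue; congr (_ + _); apply: eq_bigr => k _ /=.
    by rewrite (unsplitK (inl k)).
  by rewrite (unsplitK (inr k)).
- move=> s _ _ [n [x [y [XY ->]]]]; exists n, x, (fun k => s * y k); split.
    by move=> k; have [Xx Jy] := XY k; split=> //; apply: JM.
  by rewrite mulr_sumr; apply: eq_bigr => k _; rewrite mulrCA.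
Qed.

Lemma set_prod_subr (R : comPzRingType) (X J : set R) :
  ideal_of setT J -> set_prod X J `<=` J.
Proof.
by move=> [_ J0 JD JM]; apply: set_prod_sub => // x y _; apply: JM.
Qed.

Lemma set_prodTl (R : comPzRingType) (J : set R) :
  ideal_of setT J -> set_prod setT J = J.
Proof.
move=> idJ; apply/seteqP; split; first exact: set_prod_subr.
by move=> j Jj; rewrite -[j]mul1r; apply: mem_set_prod.
Qed.

Lemma bowtie_ideal (A B : comPzRingType) (f : {rmorphism A -> B})
    (J : set B) (I : set A) (H : set B) :
  ideal_of setT I -> ideal_of (image_plus f J) H ->
  set_prod (f @` I) J `<=` H -> H `<=` J ->
  ideal_of (amalgamation f J) (bowtie f I H).
Proof.
move=> [_ I0 ID IM] [_ H0 HD HM] fIJH HJ; split.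
- by move=> _ [i _ [h Hh <-]]; exists i => //; exists h => //; apply: HJ.
- by exists 0 => //; exists 0 => //; rewrite rmorph0 addr0.
- move=> _ _ [i Ii [h Hh <-]] [k Ik [l Hl <-]].
  exists (i + k); first exact: ID.
  exists (h + l); first exact: HD.
  by congr pair; rewrite /= rmorphD addrACA.
- move=> _ _ [a _ [j Jj <-]] [i Ii [h Hh <-]].
  exists (a * i); first exact: IM.
  exists (f i * j + (f a + j) * h).
    apply: HD; first by apply/fIJH/mem_set_prod => //; exists i.
    by apply: HM => //; exists a => //; exists j.
  by congr pair; rewrite /= rmorphM mulrDr [(_ + j) * f i]mulrDl [j * _]mulrC addrA.
Qed.

Lemma iota_bowtie (A B : comPzRingType) (f : {rmorphism A -> B})
    (I : set A) (H : set B) : H 0 -> Defs.iota f @` I `<=` bowtie f I H.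
Proof. by move=> H0 _ [i Ii <-]; exists i => //; exists 0; rewrite ?addr0. Qed.

Lemma bowtie_gen_ideal (A B : comPzRingType) (f : {rmorphism A -> B})
    (J : set B) (I : set A) :
  ideal_of setT J -> ideal_of setT I ->
  ideal_of (amalgamation f J)
    (bowtie f I (set_prod (ideal_gen setT (f @` I)) J)).
Proof.
move=> idJ idI; set H := set_prod _ J.
have [_ H0 HD HM] : ideal_of setT H by apply: set_prod_ideal.
have HJ : H `<=` J by apply: set_prod_subr.
apply: bowtie_ideal => //.
- split=> //; last by move=> s x _; apply: HM.
  by move=> h Hh; exists 0 => //; exists h; rewrite ?rmorph0 ?add0r //; apply: HJ.
- apply: set_prod_sub => // b j fIb Jj.
  by apply: mem_set_prod => //; apply: sub_smallest fIb.
Qed.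

(** The inclusion of 0 × (f(I)B) J in the extension, obtained by showing that
    the transporter of 0 × J into the extension is an ideal of all of B. *)
Lemma extension_zero_prod (A B : comPzRingType) (f : {rmorphism A -> B})
    (J : set B) (I : set A) :
  ideal_of setT J -> ideal_of (amalgamation f J) (extension f J I) ->
  set_prod (ideal_gen setT (f @` I)) J `<=` [set b | extension f J I (0, b)].
Proof.
move=> [_ J0 JD JM] [_ E0 ED EM].
have ED0 b c : extension f J I (0, b) -> extension f J I (0, c) ->
    extension f J I (0, b + c).
  move=> Eb Ec; suff -> : (0, b + c) = (0, b) + (0, c) :> A * B by apply: ED.
  by congr pair; rewrite /= addr0.
pose T := [set b | forall j, J j -> extension f J I (0, b * j)].
have idT : ideal_of setT T.
  split=> //.
  - by move=> j _; rewrite mul0r.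
  - by move=> b c Tb Tc j Jj; rewrite mulrDl; apply: ED0; [apply: Tb|apply: Tc].
  - by move=> s b _ Tb j Jj; rewrite mulrAC mulrC; apply: Tb; apply: JM.
have fIT : f @` I `<=` T.
  move=> _ [i Ii <-] j Jj.
  have -> : (0, f i * j) = (0, j) * Defs.iota f i :> A * B.
    by congr pair; rewrite /= ?mul0r // mulrC.
  apply: EM; first by exists 0 => //; exists j; rewrite ?rmorph0 ?add0r.
  by apply: sub_smallest; first exact: subset_refl; exists i.
by apply: set_prod_sub => // b j genb; apply: (genb T).
Qed.

Lemma extensionE (A B : comPzRingType) (f : {rmorphism A -> B})
    (J : set B) (I : set A) :
  ideal_of setT J -> ideal_of setT I ->
  extension f J I = bowtie f I (set_prod (ideal_gen setT (f @` I)) J).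
Proof.
move=> idJ idI; have idW := bowtie_gen_ideal A B f J I idJ idI.
have IW : Defs.iota f @` I `<=` bowtie f I (set_prod (ideal_gen setT (f @` I)) J).
  by apply: iota_bowtie; case: (set_prod_ideal B (ideal_gen setT (f @` I)) J idJ).
have idE : ideal_of (amalgamation f J) (extension f J I).
  exact: ideal_gen_ideal _ _ _ _ idW IW.
apply/seteqP; split; first exact: smallest_sub.
move=> _ [i Ii [b Hb <-]].
have -> : (i, f i + b) = Defs.iota f i + (0, b) :> A * B.
  by congr pair; rewrite /= addr0.
case: (idE) => _ _ ED _; apply: ED; last exact: (extension_zero_prod A B f J I idJ idE b Hb).
by apply: sub_smallest; first exact: subset_refl; exists i.
Qed.

Theorem proposition3p1 (A B : comPzRingType) (f : {rmorphism A -> B})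
    (J : set B) (idealJ : ideal_of setT J) :
  [/\ (forall (I : set A) (H : set B),
         ideal_of setT I ->
         ideal_of (image_plus f J) H ->
         set_prod (f @` I) J `<=` H ->
         H `<=` J ->
         ideal_of (amalgamation f J) (bowtie f I H)),
      (forall I : set A,
         ideal_of setT I ->
         extension f J I =
           bowtie f I (set_prod (ideal_gen setT (f @` I)) J)) &
      (forall I : set A,
         ideal_of setT I ->
         ideal_gen setT (f @` I) = setT ->
         extension f J I = bowtie f I J)].
Proof.
split.
- by move=> I H; apply: bowtie_ideal.
- by move=> I; apply: extensionE.
- by move=> I idI fIB; rewrite extensionE // fIB set_prodTl.
Qed.
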